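(* Let $n\ge2$, let $m_1,\ldots,m_{n-1}$ be positive integers, and let $$P(z')=\sum_{wt(K)=wt(L)=1/2} a_{KL}\,{z'}^K\,\bar{z'}^L,\qquad a_{KL}\in\mathbb C,\ a_{KL}=\bar a_{LK},$$ be a polynomial on $\mathbb C^{n-1}$ such that $P(z')>0$ whenever $z'\neq0'$. Let $\Omega$ be a domain in $\mathbb C^n$ and let $p\in\partial\Omega$ be a $(P,r)$-extreme point with $0<r\le 1$. Then for any $0<r'<r$ and any $c>0$ there exist $\epsilon_0,\gamma_0>0$ such that $$\sigma_\Omega(q)>\gamma_0\qquad\text{for all } q\in\Gamma(r',c)\cap B(p;\epsilon_0).$$
   Context: Notation: $z'=(z_1,\ldots,z_{n-1})$, and $0'$ is the origin of $\mathbb C^{n-1}$. For a multi-index $K=(k_1,\ldots,k_{n-1})\in\mathbb Z_{\ge0}^{n-1}$, $wt(K)=\sum_{j=1}^{n-1}\frac{k_j}{2m_j}$. $B(z;r)\subset\mathbb C^n$ is the ball of radius $r$ centered at $z$ and $\mathbb B^n=B(0;1)$. $(P,r)$-extreme points: for $r\in(0,1]$ set $$E_P=\{(z',z_n)\in\mathbb C^n : P(z')<2\,\mathrm{Re}(z_n)\},\qquad D(r)=\{(z',z_n)\in\mathbb C^n : |z_n-r|^2+P(z')<r^2\}.$$ For a domain $\Omega\subset\mathbb C^n$ and $r\in(0,1]$, a point $p\in\partial\Omega$ is called $(P,r)$-extreme if there exists a holomorphic embedding $f:\overline\Omega\to\overline{E_P}$ such that $f(p)=(0',0)$ and $D(r)\subset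 f(\Omega)$. (If $0<r'<r$, then $D(r')\subset D(r)$, so $p$ is then also $(P,r')$-extreme with the same $f$.) In this situation, with $f$ such an embedding, for $0<s\le r$ and $c>0$ one denotes $$\Gamma(s,c)=f^{-1}\bigl(D(s)\cap\{(z',z_n)\in\mathbb C^n : |\mathrm{Im}(z_n)|\le c\,|\mathrm{Re}(z_n)|\}\bigr).$$ Squeezing function: for a domain $\Omega\subset\mathbb C^n$, $q\in\Omega$ and a holomorphic embedding $g:\Omega\to\mathbb B^n$ with $g(q)=0$, set $\sigma_{\Omega,g}(q)=\sup\{\rho>0 : B(0;\rho)\subset g(\Omega)\}$. The squeezing function is $\sigma_\Omega(q)=\sup_g\sigma_{\Omega,g}(q)$, the supremum being over all such $g$. *)

(* Defs.v *)
(* The field of complex numbers is complex R = R[i] for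
   R : realType, and C^d is 'rV[R[i]]_d with the library's (sup-norm, hence
   usual) topology.  Notions which do not involve a supremum are defined over
   any K : numClosedFieldType, to which the library attaches the norm topology;
   there the order x < y means that y - x is a positive real, and real
   parameters are elements of K. *)
From HB Require Import structures.
From mathcomp Require Import all_boot all_order all_algebra.
From mathcomp Require Import complex.
From mathcomp Require Import all_classical all_reals all_analysis.

Set Implicit Arguments.
Unset Strict Implicit.
Unset Printing Implicit Defensive.

Import Order.TTheory GRing.Theory Num.Theory.
Import numFieldNormedType.Exports.

Local Open Scope classical_set_scope.
Local Open Scope ring_scope.

Section Holomorphy.
Variable K : numClosedFieldType.

Definition enorm d (z : 'rV[K]_d) : K := sqrtC (\sum_i `|z 0 i| ^+ 2).

Definition eball d (z : 'rV[K]_d) (rho : K) : set 'rV[K]_d :=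
  [set w | enorm (w - z) < rho].

Definition domain d (Omega : set 'rV[K]_d) : Prop :=
  [/\ Omega !=set0, open Omega & connected Omega].

Definition boundary d (A : set 'rV[K]_d) : set 'rV[K]_d :=
  closure A `\` interior A.

(* Holomorphic on a neighbourhood of A; [differentiable] is Frechet
   differentiability over the scalar field K, i.e. complex differentiability.
   Maps are total functions, only their values near A matter. *)
Definition holomorphic_on d e (A : set 'rV[K]_d)
    (f : 'rV[K]_d -> 'rV[K]_e) : Prop :=
  forall x, A x -> \forall y \near x, differentiable f y.

(* Injective holomorphic immersion which is a homeomorphism of A onto f(A);
   injectivity on A is given by the left inverse g. *)
Definition holomorphic_embedding d e (A : set 'rV[K]_d)
    (f : 'rV[K]_d -> 'rV[K]_e) : Prop :=
  [/\ holomorphic_on A f,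
      forall x, A x -> injective ('d f x) &
      exists g : 'rV[K]_e -> 'rV[K]_d,
        (forall x, A x -> g (f x) = x) /\ {within f @` A, continuous g}].

End Holomorphy.

Definition wt n (m : 'I_n -> nat) (k : {ffun 'I_n -> nat}) : rat :=
  \sum_j (k j)%:R / (2 * m j)%:R.

Lemma wt_half_le n (m : 'I_n -> nat) (k : {ffun 'I_n -> nat}) :
  (forall j, (0 < m j)%N) -> wt m k = 2^-1 -> forall j, (k j <= m j)%N.
Proof.
move=> m0 wk j.
have mj : (0 : rat) < (2 * m j)%:R by rewrite ltr0n muln_gt0 m0.
have : (k j)%:R / (2 * m j)%:R <= (2^-1 : rat).
  rewrite -wk /wt (bigD1 j) //= lerDl.
  by apply: sumr_ge0 => i _; rewrite divr_ge0 ?ler0n.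
by rewrite ler_pdivrMr // natrM mulrA mulVf // mul1r ler_nat.
Qed.

Lemma finite_wt_half n (m : 'I_n -> nat) :
  (forall j, (0 < m j)%N) ->
  finite_set [set k : {ffun 'I_n -> nat} | wt m k = 2^-1].
Proof.
move=> m0; pose N := (\max_j m j)%N.
apply: (@sub_finite_set _ _ (range (fun h : {ffun 'I_n -> 'I_N.+1} =>
  [ffun j => nat_of_ord (h j)]))); last first.
  exact/finite_image/finite_finset.
move=> k /(wt_half_le m0) km; exists [ffun j => inord (k j)] => //.
apply/ffunP => j; rewrite !ffunE inordK // ltnS.
exact: leq_trans (km j) (leq_bigmax j).
Qed.

(* The ambient space is C^(n+1): z' is made of the first n coordinates and
   zlast is the last one. *)
Section Extreme.
Variables (K : numClosedFieldType) (n : nat).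

Definition monom (k : {ffun 'I_n -> nat}) (z : 'rV[K]_n) : K :=
  \prod_j z 0 j ^+ k j.

Definition conj_row (z : 'rV[K]_n) : 'rV[K]_n := map_mx Num.conj z.

(* A finite sum when the m j are positive, by finite_wt_half. *)
Definition wpoly (m : 'I_n -> nat)
    (a : {ffun 'I_n -> nat} -> {ffun 'I_n -> nat} -> K) (z : 'rV[K]_n) : K :=
  \sum_(k \in [set k | wt m k = 2^-1]) \sum_(l \in [set l | wt m l = 2^-1])
    a k l * monom k z * monom l (conj_row z).

Definition zprime (z : 'rV[K]_n.+1) : 'rV[K]_n := col' ord_max z.
Definition zlast (z : 'rV[K]_n.+1) : K := z 0 ord_max.

Definition model (P : 'rV[K]_n -> K) : set 'rV[K]_n.+1 :=
  [set z | P (zprime z) < 2 * 'Re (zlast z)].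

Definition inner (P : 'rV[K]_n -> K) (r : K) : set 'rV[K]_n.+1 :=
  [set z | `|zlast z - r| ^+ 2 + P (zprime z) < r ^+ 2].

(* f is a map witnessing that p is a (P,r)-extreme boundary point of Omega. *)
Definition extreme_via (P : 'rV[K]_n -> K) (r : K) (Omega : set 'rV[K]_n.+1)
    (p : 'rV[K]_n.+1) (f : 'rV[K]_n.+1 -> 'rV[K]_n.+1) : Prop :=
  boundary Omega p /\
  [/\ holomorphic_embedding (closure Omega) f,
      f @` closure Omega `<=` closure (model P),
      f p = 0 &
      inner P r `<=` f @` Omega].

Definition Gamma (P : 'rV[K]_n -> K) (Omega : set 'rV[K]_n.+1)
    (f : 'rV[K]_n.+1 -> 'rV[K]_n.+1) (s c : K) : set 'rV[K]_n.+1 :=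
  closure Omega `&`
  f @^-1` (inner P s `&` [set z | `|'Im (zlast z)| <= c * `|'Re (zlast z)|]).

End Extreme.

Section Squeezing.
Local Open Scope complex_scope.
Variables (R : realType) (d : nat).

(* Both suprema are of sets bounded above by 1 when 0 < d; the second one is 0
   when no embedding exists. *)
Definition squeezing_radius (Omega : set 'rV[R[i]]_d)
    (g : 'rV[R[i]]_d -> 'rV[R[i]]_d) : R :=
  sup [set rho : R | 0 < rho /\ eball 0 rho%:C `<=` g @` Omega].

Definition squeezing (Omega : set 'rV[R[i]]_d) (q : 'rV[R[i]]_d) : R :=
  sup [set squeezing_radius Omega g | g in
    [set g : 'rV[R[i]]_d -> 'rV[R[i]]_d |
      [/\ holomorphic_embedding Omega g,
          g @` Omega `<=` eball 0 1 & g q = 0]]].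

End Squeezing.

(* Main.v *)
Require Import Defs.
From mathcomp Require Import all_boot all_order all_algebra.
From mathcomp Require Import complex.
From mathcomp Require Import all_classical all_reals all_analysis.
From mathcomp Require Import ring.

Set Implicit Arguments.
Unset Strict Implicit.
Unset Printing Implicit Defensive.

Import Order.TTheory GRing.Theory Num.Theory.
Import numFieldNormedType.Exports.
Local Open Scope classical_set_scope.
Local Open Scope complex_scope.
Local Open Scope ring_scope.

(** The model domain [P (z') < 2 Re z_n] is invariant under the weighted
    dilations [(z_j, z_n) |-> (d^(1/2m_j) z_j, d z_n)], and this is what lets
    one pass from a single point to all points near the extreme point.

    Let [w = f q], with [f q] in the inner domain of parameter [r' < r] and in
    the cone [|Im z_n| <= c |Re z_n|].  Dilating by [1 / Re w_n] moves [w] to a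
    point [y] with [Re y_n = 1], [|y_n| <= 1 + c] and [P (y') <= 2 r'], that is,
    into a fixed compact set ([compact_slab]).  The same dilation turns the
    inner domain of parameter [r] into
    [(Re w_n) |z_n|^2 + P (z') < 2 r Re z_n], which increases to
    [P (z') < 2 r Re z_n] when [w] tends to [0]; since [r' < r], it contains a
    neighbourhood of the compact set as soon as [Re w_n] is small.  Meanwhile
    the closure of the model domain is sent into itself.

    There remains to make the model domain bounded by one fixed embedding.
    The projective map [z |-> (z' / (z_n + 1), 1 / (z_n + 1))] does it: on the
    closed model domain [P (z') <= 2 Re z_n], and [P] dominates each
    [|z_j|^(2 m_j)] by homogeneity and compactness ([wnorm_le_homogeneous]), so
    [|z_j|] grows at most linearly in [1 + Re z_n] ([cayley_bounded]).  In these
    bounded coordinates the image still contains balls of a fixed radius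
    centred at the image of [y] ([inversion_near_slab]).  A translation and a
    contraction by a fixed factor put everything in the unit ball, with [q] sent
    to [0]; the radius of the ball left in the image is the lower bound for the
    squeezing function.

    All this takes place over a numerically closed field [K] whose closed disks
    are compact, the real parameters being elements of [K]; the complex numbers
    form such a field ([compact_disks_complex]). *)

(** * Holomorphic embeddings *)

Section Embedding.
Variable K : numClosedFieldType.

(** A row is the sum of its coordinates times the constant unit rows. *)
Lemma differentiable_rV (V : normedModType K) n (F : V -> 'rV[K]_n) x :
  (forall i, differentiable (fun z => F z 0 i : K) x) -> differentiable F x.
Proof.
move=> dF.
have -> : F = \sum_(i < n) (fun z => F z 0 i *: delta_mx 0 i).
  by apply/funext => z; rewrite fct_sumE [LHS]row_sum_delta.
by apply: differentiable_sum => i; exact: differentiableZl.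
Qed.

Lemma within_continuous_comp_sub (S T U : topologicalType) (A : set S)
    (B : set T) (k : S -> T) (g : T -> U) :
  k @` A `<=` B -> {within A, continuous k} -> {within B, continuous g} ->
  {within A, continuous (g \o k)}.
Proof.
move=> kAB /subspace_continuousP ck /subspace_continuousP cg.
apply/subspace_continuousP => x Ax; apply: cvg_comp (cg _ (kAB _ _)); last first.
  by exists x.
move=> W BW.
have := ck _ Ax _ BW; rewrite /nbhs/= /within/=; apply: filterS => y + Ay.
by move=> /(_ Ay); apply; apply: kAB; exists y.
Qed.

Lemma holomorphic_embedding_sub d e (A B : set 'rV[K]_d)
    (f : 'rV[K]_d -> 'rV[K]_e) :
  A `<=` B -> holomorphic_embedding B f -> holomorphic_embedding A f.
Proof.
move=> AB [hf df [g [gf cg]]]; split=> [x /AB/hf//|x /AB/df//|].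
exists g; split=> [x /AB/gf//|].
by apply: continuous_subspaceW cg; exact: image_subset.
Qed.

(** Chain rule: ['d k] is a left inverse of ['d h]. *)
Lemma injective_diff_left_inverse d e (h : 'rV[K]_d -> 'rV[K]_e)
    (k : 'rV[K]_e -> 'rV[K]_d) y :
  differentiable h y -> differentiable k (h y) ->
  (\forall z \near y, k (h z) = z) -> injective ('d h y).
Proof.
move=> dh dk kh.
have E v : 'd k (h y) ('d h y v) = v.
  have := @near_eq_derive _ _ _ (k \o h) id y v kh.
  rewrite derive_id deriveE; last exact: differentiable_comp.
  by rewrite diff_comp.
exact: can_inj E.
Qed.

(** The left inverse [k] is only asked to invert [h] near [f @` A], because the
    maps used below are holomorphic off a hyperplane only. *)
Lemma holomorphic_embedding_comp c d e (A : set 'rV[K]_c)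
    (f : 'rV[K]_c -> 'rV[K]_d) (h : 'rV[K]_d -> 'rV[K]_e)
    (k : 'rV[K]_e -> 'rV[K]_d) :
  holomorphic_embedding A f ->
  (forall x, A x -> \forall y \near f x, differentiable h y) ->
  (forall x, A x -> \forall y \near f x, k (h y) = y) ->
  (forall x, A x -> differentiable k (h (f x))) ->
  holomorphic_embedding A (h \o f).
Proof.
move=> [hf df [g [gf cg]]] dh kh dk; split.
- move=> x Ax.
  have fx : differentiable f x by exact: nbhs_singleton (hf _ Ax).
  have := differentiable_continuous fx (dh _ Ax).
  rewrite nbhs_simpl /=; apply: filterS2 (hf _ Ax) => y.
  exact: differentiable_comp.
- move=> x Ax.
  have fx : differentiable f x by exact: nbhs_singleton (hf _ Ax).
  have hfx : differentiable h (f x) by exact: nbhs_singleton (dh _ Ax).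
  rewrite diff_comp //; apply: inj_comp (df _ Ax).
  exact: injective_diff_left_inverse (hfx) (dk _ Ax) (kh _ Ax).
- have khf x : A x -> k (h (f x)) = f x.
    by move=> Ax; exact: nbhs_singleton (kh _ Ax).
  exists (g \o k); split; first by move=> x Ax /=; rewrite khf ?gf.
  apply: within_continuous_comp_sub cg.
    by move=> _ [_ [x Ax <-] <-]; exists x => //=; rewrite khf.
  apply/subspace_continuousP => _ [x Ax <-].
  apply: cvg_within_filter.
  exact: differentiable_continuous (dk _ Ax).
Qed.

End Embedding.

(** * Continuity and positivity in a field of complex numbers *)

Lemma continuous_exprn (K : numFieldType) (T : topologicalType) (f : T -> K) i :
  continuous f -> continuous (fun x => f x ^+ i).
Proof.
move=> cf x; elim: i => [|i IH]; first exact: cst_continuous.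
under eq_fun do rewrite exprS.
exact: continuousM (cf x) IH.
Qed.

Section ComplexTopology.
Variables (K : numClosedFieldType) (T : topologicalType).

Lemma continuous_conj : continuous (Num.conj : K -> K).
Proof.
move=> x; apply/(@cvgrPdist_lt _ _ _ (nbhs x)) => e e0; near=> y.
rewrite -rmorphB norm_conjC; near: y.
exact: (nbhsx_ballx x e e0).
Unshelve. all: by end_near. Qed.

Lemma continuous_Re : continuous (fun z : K => 'Re z).
Proof.
move=> x; apply/(@cvgrPdist_lt _ _ _ (nbhs x)) => e e0; near=> y.
rewrite -raddfB; apply: le_lt_trans (leif_normC_Re_Creal _) _.
near: y; exact: (nbhsx_ballx x e e0).
Unshelve. all: by end_near. Qed.

Lemma closed_preimage1 (F : T -> K) a :
  continuous F -> closed [set x | F x = a].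
Proof.
move=> cF; apply: (@closed_comp _ _ F [set a]);
  first by move=> z _; exact: cF.
exact/accessible_closed_set1/hausdorff_accessible/norm_hausdorff.
Qed.

(** The order of [K] is partial, so the condition [F x <= a] is written as the
    equation [|a - F x| = a - F x]. *)
Lemma closed_preimage_le (F : T -> K) a :
  continuous F -> closed [set x | F x <= a].
Proof.
move=> cF; rewrite (_ : mkset _ = [set x | `|a - F x| - (a - F x) = 0]).
  apply: closed_preimage1 => x.
  have cB : {for x, continuous (fun z => a - F z)}.
    by apply: continuousB; [exact: cst_continuous|exact: cF].
  apply: continuousB (cB).
  exact: (@continuous_comp _ _ _ _ (Num.norm : K -> K) _ cB
    (@norm_continuous _ _ _)).
apply/seteqP; split=> x /=.
  by rewrite -subr_ge0 => /ger0_norm ->; rewrite subrr.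
by move=> /eqP; rewrite subr_eq0 => /eqP; rewrite -subr_ge0 => <-.
Qed.

Lemma near_neq0 (F : T -> K) x :
  {for x, continuous F} -> F x != 0 -> \forall y \near x, F y != 0.
Proof.
move=> cF F0; have : 0 < `|F x| by rewrite normr_gt0.
have /(@cvgrPdist_lt _ _ _ (nbhs x)) /[apply] := cF.
apply: filterS => y; apply: contraTneq => ->.
by rewrite subr0 ltxx.
Qed.

(** Without the reality assumption, the values of [F] near [x] could be
    incomparable with [0]. *)
Lemma near_gt0 (F : T -> K) x :
  {for x, continuous F} -> (forall y, F y \is Num.real) -> 0 < F x ->
  \forall y \near x, 0 < F y.
Proof.
move=> cF rF F0.
have /(@cvgrPdist_lt _ _ _ (nbhs x)) /(_ _ F0) := cF.
apply: filterS => y; rewrite real_ltr_distl ?rpredB ?rF // => /andP[_].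
by rewrite ltrDr.
Qed.

End ComplexTopology.

Section CoordinateContinuity.
Variables (K : numClosedFieldType) (n : nat).

Lemma continuous_zprime : continuous (@zprime K n).
Proof.
move=> z; apply: differentiable_continuous; apply: differentiable_rV => i.
under eq_fun do rewrite mxE.
exact: differentiable_coord.
Qed.

Lemma continuous_comp_zprime (P : 'rV[K]_n -> K) : continuous P ->
  continuous (fun z : 'rV[K]_n.+1 => P (zprime z)).
Proof.
by move=> cP z; apply: (continuous_comp (@continuous_zprime z)); exact: cP.
Qed.

Lemma continuous_Re_zlast : continuous (fun z : 'rV[K]_n.+1 => 'Re (zlast z)).
Proof.
move=> z; apply: (@continuous_comp _ _ _ (@zlast K n) (fun z : K => 'Re z)).
  exact: coord_continuous.
exact: continuous_Re.
Qed.

Lemma continuous_norm_zlast : continuous (fun z : 'rV[K]_n.+1 => `|zlast z|).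
Proof.
move=> z; apply: (@continuous_comp _ _ _ (@zlast K n) (Num.norm : K -> K)).
  exact: coord_continuous.
exact: norm_continuous.
Qed.

End CoordinateContinuity.

(** * Weighted dilations and weighted homogeneous functions *)

Section Dilation.
Variables (K : numClosedFieldType) (n : nat) (m : 'I_n -> nat).
Hypothesis m_gt0 : forall j, (0 < m j)%N.

(** The dilation factors [d^(1/2m_j)] and [d] are obtained from [t] with
    [d = t^(2 wprod)]: as [m j] divides [wprod], all exponents are then natural
    numbers. *)
Definition wprod : nat := \prod_j m j.

Definition pdilate (t : K) (z : 'rV[K]_n) : 'rV[K]_n :=
  \row_j (t ^+ (wprod %/ m j) * z 0 j).

Definition dilate_weight (t : K) (i : 'I_n.+1) : K :=
  if unlift ord_max i is Some j then t ^+ (wprod %/ m j) else t ^+ (2 * wprod).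

Definition dilate (t : K) (z : 'rV[K]_n.+1) : 'rV[K]_n.+1 :=
  \row_i (dilate_weight t i * z 0 i).

Lemma wprod_gt0 : (0 < wprod)%N.
Proof. by rewrite /wprod prodn_gt0. Qed.

Lemma wprod_divK j : (wprod %/ m j * m j)%N = wprod.
Proof. by rewrite divnK // /wprod (bigD1 j) //= dvdn_mulr. Qed.

Lemma zprime_dilate t z : zprime (dilate t z) = pdilate t (zprime z).
Proof. by apply/rowP => j; rewrite !mxE /dilate_weight liftK. Qed.

Lemma zlast_dilate t z : zlast (dilate t z) = t ^+ (2 * wprod) * zlast z.
Proof. by rewrite /zlast mxE /dilate_weight unlift_none. Qed.

Lemma dilateK t : t != 0 -> cancel (dilate t) (dilate t^-1).
Proof.
move=> t0 z; apply/rowP => i; rewrite !mxE mulrA /dilate_weight.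
by case: unlift => [j|]; rewrite -exprMn mulVf // expr1n mul1r.
Qed.

Lemma differentiable_dilate t z : differentiable (dilate t) z.
Proof.
apply: differentiable_rV => i.
under eq_fun do rewrite mxE.
exact/differentiableZ/differentiable_coord.
Qed.

(** The condition [wt m k = 1/2], multiplied by [2 wprod]. *)
Lemma wt_half_exponent (k : {ffun 'I_n -> nat}) : wt m k = 2^-1 ->
  (\sum_j wprod %/ m j * k j)%N = wprod.
Proof.
move=> wk; apply/eqP; rewrite -(eqr_nat rat) natr_sum.
have -> : wprod%:R = (2 * wprod%:R) * wt m k :> rat.
  by rewrite wk mulrAC mulfV ?mul1r.
rewrite mulr_sumr; apply/eqP/eq_bigr => j _.
have mj : (m j)%:R != 0 :> rat by rewrite pnatr_eq0 -lt0n.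
by rewrite -[in RHS](wprod_divK j) !natrM; field.
Qed.

Lemma monom_pdilate t (k : {ffun 'I_n -> nat}) z : wt m k = 2^-1 ->
  monom k (pdilate t z) = t ^+ wprod * monom k z.
Proof.
move=> wk; rewrite /monom -[in RHS](wt_half_exponent wk) -prodrXr -big_split.
by apply: eq_bigr => j _; rewrite mxE exprMn exprM.
Qed.

Definition homogeneous (P : 'rV[K]_n -> K) : Prop :=
  forall t z, 0 < t -> P (pdilate t z) = t ^+ (2 * wprod) * P z.

(** The holomorphic and the antiholomorphic monomial, both of weight [1/2],
    contribute a factor [t ^+ wprod] each. *)
Lemma wpoly_homogeneous a : homogeneous (wpoly m a).
Proof.
move=> t z t0; have fw := finite_wt_half m_gt0.
have conjd : conj_row (pdilate t z) = pdilate t (conj_row z).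
  apply/rowP => j; rewrite !mxE rmorphM rmorphXn /=.
  by congr (_ ^+ _ * _); apply/CrealP/gtr0_real.
rewrite /wpoly !fsbig_finite //= mulr_sumr.
rewrite !big_seq; apply: eq_bigr => k; rewrite in_fset_set // inE /= => wk.
rewrite !fsbig_finite //= mulr_sumr.
rewrite !big_seq; apply: eq_bigr => l; rewrite in_fset_set // inE /= => wl.
rewrite conjd !monom_pdilate // mulnC exprM expr2; ring.
Qed.

Lemma continuous_monom (k : {ffun 'I_n -> nat}) :
  continuous (monom k : 'rV[K]_n -> K).
Proof.
rewrite /monom; apply: continuous_big; first exact: mul_continuous.
move=> j _.
exact/continuous_exprn/coord_continuous.
Qed.

Lemma monom_conj (k : {ffun 'I_n -> nat}) (z : 'rV[K]_n) :
  monom k (conj_row z) = (monom k z)^*.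
Proof. by rewrite rmorph_prod; apply: eq_bigr => j _; rewrite rmorphXn mxE. Qed.

Lemma continuous_wpoly a : continuous (wpoly m a : 'rV[K]_n -> K).
Proof.
have fw := finite_wt_half m_gt0.
pose D := finmap.enum_fset (fset_set [set k | wt m k = 2^-1]).
have -> : wpoly m a = fun z => \sum_(k <- D) \sum_(l <- D)
    a k l * monom k z * monom l (conj_row z).
  apply/funext => z; rewrite /wpoly fsbig_finite //=.
  by apply: eq_bigr => k _; rewrite fsbig_finite.
apply: continuous_big => [|k _]; first exact: add_continuous.
apply: continuous_big => [|l _ z]; first exact: add_continuous.
have cM k' : {for z, continuous (monom k' : 'rV[K]_n -> K)}.
  exact: continuous_monom.
have cJ : {for z, continuous (fun z : 'rV[K]_n => monom l (conj_row z))}.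
  rewrite (_ : (fun z => _) = Num.conj \o monom l); last first.
    by apply/funext => y; rewrite monom_conj.
  by apply: continuous_comp; [exact: continuous_monom|exact: continuous_conj].
have ca : {for z, continuous (fun=> a k l : K)} by exact: cst_continuous.
exact: continuousM (continuousM ca (cM k)) cJ.
Qed.

End Dilation.

(** * Positive weighted homogeneous functions dominate their weighted norm *)

(** The only property of the complex numbers used besides algebra and order. *)
Definition compact_disks (K : numClosedFieldType) : Prop :=
  forall B : K, compact [set x : K | `|x| <= B].

Lemma compact_polydisk (K : numClosedFieldType) n (B : K) : compact_disks K ->
  compact [set z : 'rV[K]_n | forall i, `|z 0 i| <= B].
Proof.
by move=> hK; apply: (@rV_compact K n (fun=> [set x : K | `|x| <= B])) => i.
Qed.

(** The condition [|i| <= |F x|] holds for [x'] near [x] and [i] near [0]; by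
    compactness [i] can be chosen independently of [x]. *)
Lemma compact_away_from_zero (K : numFieldType) (T : topologicalType)
    (A : set T) (F : T -> K) :
  compact A -> continuous F -> (forall x, A x -> F x != 0) ->
  exists2 e : K, 0 < e & forall x, A x -> e <= `|F x|.
Proof.
move=> /compact_near_coveringP cA cF F0.
have /nbhs_ballP[e /= e0 he] :
    \forall i \near (0 : K), A `<=` (fun x => `|i| <= `|F x|).
  apply: (cA K (nbhs (0 : K)) (fun i x => `|i| <= `|F x|)) => x Ax.
  have a0 : 0 < `|F x| / 2 by rewrite divr_gt0 // normr_gt0 F0.
  exists ([set x' | `|F x - F x'| < `|F x| / 2], ball (0 : K) (`|F x| / 2)).
    split; last exact: nbhsx_ballx.
    by have /(@cvgrPdist_lt _ _ _ (nbhs x)) := cF x; apply.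
  move=> [x' i] /= [Fx']; rewrite /ball /= sub0r normrN => /ltW/le_trans; apply.
  have := lerB_dist (F x) (F x - F x').
  rewrite subKr; apply: le_trans.
  rewrite lerBrDl -lerBrDr (le_trans (ltW Fx')) //.
  by rewrite {2}[`|F x|]splitr addrK.
exists (e / 2); first exact: divr_gt0.
move=> x Ax; have e20 : 0 < e / 2 by exact: divr_gt0.
have := he (e / 2); rewrite /ball /= sub0r normrN gtr0_norm //.
by apply => //; rewrite ltr_pdivrMr // ltr_pMr // ltr1n.
Qed.

Section WeightedNorm.
Variables (K : numClosedFieldType) (n : nat) (m : 'I_n -> nat).
Hypothesis m_gt0 : forall j, (0 < m j)%N.
Variable P : 'rV[K]_n -> K.
Hypotheses (P_homogeneous : homogeneous m P) (P_continuous : continuous P).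
Hypothesis P_gt0 : forall z, z != 0 -> 0 < P z.

Definition wnorm (z : 'rV[K]_n) : K := \sum_j `|z 0 j| ^+ (2 * m j).

Lemma wnorm_ge0 z : 0 <= wnorm z.
Proof. by apply: sumr_ge0 => j _; rewrite exprn_ge0. Qed.

Lemma wnorm_coord (z : 'rV[K]_n) j : `|z 0 j| ^+ (2 * m j) <= wnorm z.
Proof.
rewrite /wnorm (bigD1 j) //= lerDl.
by apply: sumr_ge0 => i _; rewrite exprn_ge0.
Qed.

Lemma wnorm_eq0 z : wnorm z = 0 -> z = 0.
Proof.
move=> z0; apply/rowP => j; rewrite mxE; apply/eqP.
have : `|z 0 j| ^+ (2 * m j) == 0 by rewrite eq_le -{1}z0 wnorm_coord exprn_ge0.
by rewrite expf_eq0 normr_eq0 => /andP[].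
Qed.

Lemma wnorm_homogeneous : homogeneous m wnorm.
Proof.
move=> t z t0; rewrite /wnorm mulr_sumr; apply: eq_bigr => j _.
rewrite mxE normrM normrX (gtr0_norm t0) exprMn -exprM.
by rewrite mulnCA -[in RHS](wprod_divK m j).
Qed.

Lemma continuous_wnorm : continuous wnorm.
Proof.
apply: continuous_big; first exact: add_continuous.
move=> j _; apply: continuous_exprn => z.
by apply: continuous_comp; [exact: coord_continuous|exact: norm_continuous].
Qed.

(** The origin is fixed by the dilation of factor [2]. *)
Lemma homogeneous_at0 : P 0 = 0.
Proof.
have := P_homogeneous 0 (ltr0n K 2); rewrite (_ : pdilate _ _ _ = 0); last first.
  by apply/rowP => j; rewrite !mxE mulr0.
move/eqP; rewrite -subr_eq0 -{1}[P 0]mul1r -mulrBl mulf_eq0 => /orP[|/eqP//].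
by rewrite subr_eq0 eq_sym pexpr_eq1 ?muln_gt0 ?wprod_gt0 // (eqr_nat _ 2 1).
Qed.

Lemma homogeneous_ge0 z : 0 <= P z.
Proof. by have [->|/P_gt0/ltW//] := eqVneq z 0; rewrite homogeneous_at0. Qed.

(** Both sides are homogeneous of the same degree, so it is enough to compare
    them on the compact set [wnorm z = 1], which meets every orbit of the
    dilations other than the origin; there [P] is bounded away from [0]. *)
Lemma wnorm_le_homogeneous : compact_disks K ->
  exists2 C : K, 0 < C & forall z, wnorm z <= C * P z.
Proof.
move=> hK.
have cS : compact [set z | wnorm z = 1].
  apply: (subclosed_compact _ (@compact_polydisk _ n 1 hK)).
    exact/closed_preimage1/continuous_wnorm.
  move=> z /= z1 i; have := wnorm_coord z i; rewrite z1.
  by rewrite expr_le1 // muln_gt0 m_gt0.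
have [|e e0 he] := @compact_away_from_zero _ _ _ P cS P_continuous.
  move=> z /= z1; apply/lt0r_neq0/P_gt0; apply: contra_eq_neq z1 => ->.
  rewrite eq_sym /wnorm big1 ?oner_eq0 // => j _.
  by rewrite mxE normr0 expr0n muln_eq0 /= eqn0Ngt m_gt0.
exists e^-1; first by rewrite invr_gt0.
move=> z; rewrite ler_pdivlMl //.
have [z0|N0] := eqVneq (wnorm z) 0.
  by rewrite z0 mulr0 homogeneous_ge0.
have M0 : (0 < 2 * wprod m)%N by rewrite muln_gt0 wprod_gt0.
have N_gt0 : 0 < wnorm z by rewrite lt0r N0 wnorm_ge0.
pose t := (2 * wprod m).-root (wnorm z)^-1.
have t0 : 0 < t by rewrite rootC_gt0 // invr_gt0.
have tN : t ^+ (2 * wprod m) = (wnorm z)^-1 by rewrite rootCK.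
have := he (pdilate m t z); rewrite /= wnorm_homogeneous // tN mulVf //.
move=> /(_ erefl); rewrite ger0_norm ?homogeneous_ge0 // P_homogeneous // tN.
by rewrite ler_pdivlMl // mulrC.
Qed.

End WeightedNorm.

(** * A projective involution making the model domain bounded *)

Section Inversion.
Variables (K : numClosedFieldType) (n : nat).
Implicit Types z : 'rV[K]_n.+1.

(** In homogeneous coordinates this exchanges the last affine coordinate with the
    homogenizing one, hence it is an involution. *)
Definition inversion z : 'rV[K]_n.+1 :=
  \row_i ((if i == ord_max then 1 else z 0 i) / zlast z).

Definition elast : 'rV[K]_n.+1 := delta_mx 0 ord_max.

Lemma zlast_inversion z : zlast (inversion z) = (zlast z)^-1.
Proof. by rewrite /zlast mxE eqxx mul1r. Qed.

Lemma zlastD z w : zlast (z + w) = zlast z + zlast w.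
Proof. by rewrite /zlast mxE. Qed.

Lemma zlast_elast : zlast elast = 1.
Proof. by rewrite /zlast mxE !eqxx. Qed.

Lemma inversionK z : zlast z != 0 -> inversion (inversion z) = z.
Proof.
move=> z0; apply/rowP => i; rewrite mxE zlast_inversion invrK mxE.
case: eqP => [->|_]; last by rewrite mulfVK.
by rewrite mul1r.
Qed.

Lemma differentiable_zlast z : differentiable (@zlast K n) z.
Proof. exact: differentiable_coord. Qed.

Lemma differentiable_inversion z :
  zlast z != 0 -> differentiable inversion z.
Proof.
move=> z0; apply: differentiable_rV => i.
under eq_fun do rewrite mxE.
apply: differentiableM; last exact/differentiableV/z0/differentiable_zlast.
by case: eqP => _; [exact: differentiable_cst|exact: differentiable_coord].
Qed.

End Inversion.

(** * Geometry of the model domain in bounded coordinates *)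

Section ModelDomain.
Variables (K : numClosedFieldType) (n : nat) (m : 'I_n -> nat).
Hypothesis m_gt0 : forall j, (0 < m j)%N.
Variable P : 'rV[K]_n -> K.
Hypotheses (P_homogeneous : homogeneous m P) (P_continuous : continuous P).
Hypothesis P_gt0 : forall z, z != 0 -> 0 < P z.
Hypothesis hK : compact_disks K.

Let P_ge0 z : 0 <= P z.
Proof. exact: homogeneous_ge0 P_homogeneous P_gt0 z. Qed.

Definition cayley (z : 'rV[K]_n.+1) : 'rV[K]_n.+1 := inversion (z + elast K n).

Lemma zprime_coord (z : 'rV[K]_n.+1) j : z 0 (lift ord_max j) = zprime z 0 j.
Proof. by rewrite mxE. Qed.

Lemma norm_shift_ge (z : 'rV[K]_n.+1) :
  0 <= 'Re (zlast z) -> 1 + 'Re (zlast z) <= `|zlast (z + elast K n)|.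
Proof.
move=> z0; rewrite zlastD zlast_elast addrC.
apply: le_trans (leif_normC_Re_Creal _).
have -> : 'Re (zlast z + 1) = 'Re (zlast z) + 1.
  by rewrite raddfD /=; congr (_ + _); exact/Creal_ReP/rpred1.
by rewrite real_ler_norm // rpredD ?rpred1 ?Creal_Re.
Qed.

Lemma shift_neq0 (z : 'rV[K]_n.+1) :
  0 <= 'Re (zlast z) -> zlast (z + elast K n) != 0.
Proof.
move=> z0; rewrite -normr_gt0; apply: lt_le_trans (norm_shift_ge z0).
exact: ltr_pwDl.
Qed.

(** [x <= 1 + x ^+ k] for every real [x >= 0] and [k > 0]. *)
Lemma coord_le C (z : 'rV[K]_n) j : (forall z, wnorm m z <= C * P z) ->
  `|z 0 j| <= 1 + C * P z.
Proof.
move=> hC; apply: le_trans (_ : 1 + wnorm m z <= _); last by rewrite lerD2l.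
apply: le_trans (_ : 1 + `|z 0 j| ^+ (2 * m j) <= _); last first.
  by rewrite lerD2l wnorm_coord.
have [z1|z1] := real_leP (normr_real (z 0 j)) (real1 K).
  by rewrite -[leLHS]addr0 lerD // exprn_ge0.
rewrite -[leLHS]add0r lerD // ler_eXnr ?muln_gt0 ?m_gt0 //.
exact: ltW.
Qed.

(** On the closed model domain the denominator has modulus at least
    [1 + Re z_n], and each numerator is at most [1 + 2 C Re z_n]. *)
Lemma cayley_bounded : exists2 B : K, 0 < B &
  forall z, P (zprime z) <= 2 * 'Re (zlast z) -> forall i, `|cayley z 0 i| <= B.
Proof.
have [C C0 hC] := wnorm_le_homogeneous m_gt0 P_homogeneous P_continuous P_gt0 hK.
exists (1 + 2 * C); first by rewrite addr_gt0 // mulr_gt0.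
move=> z Pz i.
have Re0 : 0 <= 'Re (zlast z).
  by rewrite -(@pmulr_rge0 _ 2) //; apply: le_trans Pz.
have z1 := norm_shift_ge Re0.
have z10 : 0 < `|zlast (z + elast K n)| by rewrite normr_gt0 shift_neq0.
rewrite mxE normrM normfV ler_pdivrMr //.
apply: le_trans (_ : (1 + 2 * C) * (1 + 'Re (zlast z)) <= _); last first.
  by rewrite ler_pM2l // addr_gt0 // mulr_gt0.
have hR : 0 <= 2 * C + 'Re (zlast z) by rewrite addr_ge0 // mulr_ge0 // ltW.
case: eqP => [_|/eqP i_max].
  rewrite normr1 -subr_ge0.
  rewrite (_ : _ - 1 = 2 * C + 'Re (zlast z) + 2 * C * 'Re (zlast z)); last by ring.
  by rewrite addr_ge0 // !mulr_ge0 // ltW.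
have [j ji|ie] := unliftP ord_max i; last by rewrite ie eqxx in i_max.
rewrite mxE ji zprime_coord [elast _ _ _ _]mxE [lift _ _ == _]eq_sym.
rewrite (negPf (neq_lift _ _)) andbF addr0.
apply: le_trans (coord_le _ _ hC) _.
apply: le_trans (_ : 1 + C * (2 * 'Re (zlast z)) <= _).
  by rewrite lerD2l ler_pM2l.
rewrite -subr_ge0 (_ : _ - _ = 2 * C + 'Re (zlast z)) //; ring.
Qed.

(** Contains the dilations by [1 / Re w_n] of the points [w] of the inner domain
    of parameter [s] that lie in the cone [|Im w_n| <= c |Re w_n|]. *)
Definition slab (c s : K) : set 'rV[K]_n.+1 :=
  [set z | 'Re (zlast z) = 1] `&` [set z | `|zlast z| <= 1 + c] `&`
  [set z | P (zprime z) <= 2 * s].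

Lemma compact_slab c s : 0 <= c -> 0 <= s -> compact (slab c s).
Proof.
move=> c0 s0.
have [C C0 hC] := wnorm_le_homogeneous m_gt0 P_homogeneous P_continuous P_gt0 hK.
have polydisk := @compact_polydisk _ n.+1 (1 + c + (1 + C * (2 * s))) hK.
apply: (subclosed_compact _ polydisk).
  apply: closedI; first apply: closedI.
  - exact/closed_preimage1/continuous_Re_zlast.
  - exact/closed_preimage_le/continuous_norm_zlast.
  - exact/closed_preimage_le/continuous_comp_zprime.
move=> z [[/= _ z1] Pz] i.
have Cs : 0 <= 1 + C * (2 * s) by rewrite addr_ge0 // !mulr_ge0 // ltW.
have [j ->|->] := unliftP ord_max i.
  rewrite zprime_coord -[leLHS]add0r lerD // ?addr_ge0 //.
  by apply: le_trans (coord_le _ _ hC) _; rewrite lerD2l ler_pM2l.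
by rewrite -[leLHS]addr0 lerD.
Qed.

(** The strict inequality in the conclusion describes the inner domain of
    parameter [r] dilated by [1 / eta].  It holds at the points of the slab, as
    [s < r], and it is an open condition; compactness of the slab provides one
    radius [rho] for all its points.  The displacement [u] is made after passing
    to bounded coordinates, since balls are wanted there. *)
Lemma inversion_near_slab (r s c : K) : 0 < s -> s < r -> 0 < c ->
  exists eta rho : K, [/\ 0 < eta, 0 < rho &
   forall y (u : 'rV[K]_n.+1), slab c s y -> (forall i, `|u 0 i| < rho) ->
    let v := cayley y + u in let y' := inversion v - elast K n in
    zlast v != 0 /\
    eta * `|zlast y'| ^+ 2 + P (zprime y') < 2 * r * 'Re (zlast y')].
Proof.
move=> s0 sr c0.
have c1 : 0 < 1 + c by rewrite addr_gt0.
have r0 : 0 < r by exact: lt_trans sr.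
have rs : 0 < r - s by rewrite subr_gt0.
(* eta |y_n|^2 uses at most half of the room 2 r - 2 s left on the slab. *)
pose eta := (r - s) / (1 + c) ^+ 2.
have eta0 : 0 < eta by rewrite divr_gt0 // exprn_gt0.
pose G (y : 'rV[K]_n.+1) :=
  2 * r * 'Re (zlast y) - (eta * `|zlast y| ^+ 2 + P (zprime y)).
have rG y : G y \is Num.real.
  apply: rpredB; first by rewrite rpredM ?Creal_Re // ger0_real // mulr_ge0 // ltW.
  by rewrite ger0_real // addr_ge0 // mulr_ge0 ?exprn_ge0 // ltW.
have cG y : {for y, continuous G}.
  have cN : {for y, continuous (fun y : 'rV[K]_n.+1 => `|zlast y| ^+ 2)}.
    exact/continuous_exprn/continuous_norm_zlast.
  have cc a : {for y, continuous (fun=> a : K)} by exact: cst_continuous.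
  exact: continuousB (continuousM (cc _) (@continuous_Re_zlast _ _ y))
    (continuousD (continuousM (cc _) cN)
                 (@continuous_comp_zprime _ _ _ P_continuous y)).
have G0 y : slab c s y -> 0 < G y.
  move=> [[/= Re1 y1] Py]; rewrite /G Re1 subr_gt0 mulr1.
  apply: le_lt_trans (_ : (r - s) + 2 * s < _).
    rewrite lerD // /eta mulrAC ler_pdivrMr ?exprn_gt0 // ler_pM2l //.
    by rewrite lerXn2r // ?nnegrE ?ltW.
  rewrite -subr_gt0 (_ : _ - _ = r - s) //; ring.
pose U (v : 'rV[K]_n.+1) := zlast v != 0 /\ 0 < G (inversion v - elast K n).
have nU y : slab c s y -> \forall v \near cayley y, U v.
  move=> hy; have Re0 : 0 <= 'Re (zlast y) by case: hy => [[/= -> _] _].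
  have cy0 : zlast (cayley y) != 0.
    by rewrite zlast_inversion invr_eq0 shift_neq0.
  near=> v; split; near: v.
    exact: (@near_neq0 _ _ (@zlast K n) _ (@coord_continuous _ _ _ _ _ _)) cy0.
  apply: (@near_gt0 _ _ (fun v => G (inversion v - elast K n))) => //; last first.
    by rewrite inversionK ?shift_neq0 // addrK; exact: G0.
  apply: (@continuous_comp _ _ _ (fun v => inversion v - elast K n) G).
    apply: continuousB; last exact: cst_continuous.
    exact/differentiable_continuous/differentiable_inversion.
  exact: cG.
have /compact_near_coveringP cS := compact_slab (ltW c0) (ltW s0).
have /nbhs_ballP[rho /= rho0 hrho] :
    \forall u \near (0 : 'rV[K]_n.+1), slab c s `<=` (fun y => U (cayley y + u)).
  apply: (cS _ (nbhs (0 : 'rV[K]_n.+1)) (fun u y => U (cayley y + u))) => y hy.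
  have Re0 : 0 <= 'Re (zlast y) by case: hy => [[/= -> _] _].
  have cc : {for y, continuous cayley}.
    apply: continuous_comp; last first.
      by apply/differentiable_continuous/differentiable_inversion/shift_neq0.
    apply: continuousD; last exact: cst_continuous.
    exact: cvg_id.
  have cF : (cayley p.1 + p.2) @[p --> (y, 0 : 'rV[K]_n.+1)] --> cayley y.
    rewrite -[X in _ --> X]addr0; apply: cvgD; last exact: cvg_snd.
    by apply: (@cvg_comp _ _ _ fst cayley); [exact: cvg_fst|exact: cc].
  exact: cF (nU _ hy).
exists eta, rho; split => // y u hy hu.
have [|v0] := hrho u _ y hy.
  by split=> // i j; rewrite ord1 /ball /= mxE sub0r normrN; exact: hu.
by rewrite subr_gt0; split.
Unshelve. all: by end_near. Qed.

End ModelDomain.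

(** * Rescaled embeddings at an extreme point *)

Section ExtremePoint.
Variables (K : numClosedFieldType) (n : nat) (m : 'I_n -> nat).
Hypothesis m_gt0 : forall j, (0 < m j)%N.
Variable P : 'rV[K]_n -> K.
Hypotheses (P_homogeneous : homogeneous m P) (P_continuous : continuous P).
Hypothesis P_gt0 : forall z, z != 0 -> 0 < P z.
Hypothesis hK : compact_disks K.

Let P_ge0 z : 0 <= P z.
Proof. exact: homogeneous_ge0 P_homogeneous P_gt0 z. Qed.

(** Expand [|z_n - r|^2]; the term [r^2] cancels. *)
Lemma innerE (r : K) z : 0 < r ->
  inner P r z <-> `|zlast z| ^+ 2 + P (zprime z) < 2 * r * 'Re (zlast z).
Proof.
move=> r0; have rr : r \is Num.real by exact: gtr0_real.
rewrite /inner /= !normC2_Re_Im !raddfB /= (Creal_ReP _ rr) (Creal_ImP _ rr) subr0.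
set x := 'Re (zlast z); set y := 'Im (zlast z); set v := P (zprime z).
suff -> : ((x - r) ^+ 2 + y ^+ 2 + v < r ^+ 2) = (x ^+ 2 + y ^+ 2 + v < 2 * r * x).
  by [].
rewrite -subr_gt0 -[RHS]subr_gt0; congr (0 < _); ring.
Qed.

Lemma closure_model z :
  closure (model P) z -> P (zprime z) <= 2 * 'Re (zlast z).
Proof.
pose F (z : 'rV[K]_n.+1) := P (zprime z) - 2 * 'Re (zlast z).
have cF : continuous F.
  move=> y.
  have cc : {for y, continuous (fun=> 2 : K)} by exact: cst_continuous.
  exact: continuousB (@continuous_comp_zprime _ _ _ P_continuous y)
    (continuousM cc (@continuous_Re_zlast _ _ y)).
have clF := closed_preimage_le (a := 0) cF.
move=> cz; rewrite -subr_le0; apply: clF; apply: closure_subset cz => y /= ym.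
by rewrite subr_le0 ltW.
Qed.

Lemma enorm_coord d (z : 'rV[K]_d) i : `|z 0 i| <= enorm z.
Proof.
rewrite -[leLHS](@sqrCK _ `|z 0 i|) // ler_sqrtC ?qualifE /= ?exprn_ge0 ?sumr_ge0 //.
by rewrite (bigD1 i) //= lerDl sumr_ge0 // => j _; rewrite exprn_ge0.
Qed.

Lemma enorm_lt1 d (z : 'rV[K]_d) :
  (forall i, `|z 0 i| <= d.+1%:R^-1) -> enorm z < 1.
Proof.
move=> hz; rewrite /enorm -[ltRHS]sqrtC1 ltr_sqrtC ?qualifE /= ?sumr_ge0 //.
apply: le_lt_trans (_ : \sum_(i < d) d.+1%:R^-1 ^+ 1 < _).
  apply: ler_sum => i _; rewrite expr2 expr1.
  apply: le_trans (ler_pM _ _ (hz i) (hz i)) _ => //.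
  by rewrite ler_piMr ?invr_ge0 // invf_le1 ?ltr0n // ler1n.
rewrite sumr_const card_ord expr1 -[_ *+ d]mulr_natl ltr_pdivrMr ?ltr0n //.
by rewrite mul1r ltr_nat.
Qed.

Lemma holomorphic_embedding_affine_cayley d (A : set 'rV[K]_d) f t s b :
  holomorphic_embedding A f -> t != 0 -> s != 0 ->
  (forall x, A x -> 0 <= 'Re (zlast (dilate m t (f x)))) ->
  holomorphic_embedding A (fun x => s *: (cayley (dilate m t (f x)) - b)).
Proof.
move=> ef t0 s0 hA.
pose h z := s *: (cayley (dilate m t z) - b).
pose k u := dilate m t^-1 (inversion (s^-1 *: u + b) - elast K n).
have dsh z : differentiable (fun z => dilate m t z + elast K n) z.
  apply: differentiableD; last exact: differentiable_cst.
  exact: differentiable_dilate.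
have near0 x : A x -> \forall y \near f x, zlast (dilate m t y + elast K n) != 0.
  move=> Ax; apply: (@near_neq0 _ _ (fun y => zlast (dilate m t y + elast K n))).
    apply: differentiable_continuous.
    exact: (differentiable_comp (dsh _) (differentiable_zlast _)).
  exact/shift_neq0/hA.
have hkE y : s^-1 *: h y + b = cayley (dilate m t y).
  by rewrite /h scalerA mulVf // scale1r subrK.
apply: (holomorphic_embedding_comp (h := h) (k := k) ef) => x Ax.
- apply: filterS (near0 _ Ax) => y y0.
  apply: differentiableZ; apply: differentiableB; last exact: differentiable_cst.
  exact: (differentiable_comp (dsh _) (differentiable_inversion y0)).
- apply: filterS (near0 _ Ax) => y y0.
  by rewrite /k hkE inversionK // addrK dilateK.
- apply: (@differentiable_comp _ _ _ _
    (fun u => inversion (s^-1 *: u + b) - elast K n) (dilate m t^-1));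
    last exact: differentiable_dilate.
  apply: differentiableB; last exact: differentiable_cst.
  apply: (@differentiable_comp _ _ _ _ (fun u => s^-1 *: u + b) (@inversion K n)).
    apply: differentiableD; last exact: differentiable_cst.
    exact/differentiableZ/ex_diff.
  rewrite hkE; apply: differentiable_inversion.
  by rewrite zlast_inversion invr_eq0; exact/shift_neq0/hA.
Qed.

Variables (Omega : set 'rV[K]_n.+1) (p : 'rV[K]_n.+1).
Variables (f : 'rV[K]_n.+1 -> 'rV[K]_n.+1) (r : K).
Hypothesis hf : extreme_via P r Omega p f.

(** [f] is continuous at [p], with [f p = 0]. *)
Lemma near_extreme_zlast eta : 0 < eta ->
  exists2 eps : K, 0 < eps & forall x, eball p eps x -> `|zlast (f x)| < eta.
Proof.
move=> eta0; case: hf => [[clp _] [[hol _ _] _ fp _]].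
have fdiff : differentiable f p by exact: nbhs_singleton (hol _ clp).
have cz : {for p, continuous (@zlast K n \o f)}.
  apply: differentiable_continuous.
  exact: (differentiable_comp fdiff (differentiable_zlast _)).
have /(@cvgrPdist_lt _ _ _ (nbhs p)) /(_ _ eta0) := cz.
move=> /nbhs_ballP[eps /= eps0 heps]; exists eps => // x xp.
have zfp : zlast (f p) = 0 by rewrite fp /zlast mxE.
have := heps x; rewrite /= zfp sub0r normrN; apply; split => // i j.
rewrite ord1 /ball /= distrC; apply: le_lt_trans xp.
by have := enorm_coord (x - p) j; rewrite !mxE.
Qed.

(** The embedding attached to [q] is [f] followed by the dilation by
    [1 / Re (f q)_n], by [cayley], and by the affine map that centres the image
    of [q] at [0] and fits everything in the unit ball; [eps] and [gamma] do not
    depend on [q]. *)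
Lemma uniform_embedding_at_extreme_point s c : 0 < s -> s < r -> 0 < c ->
  exists eps gamma : K, [/\ 0 < eps, 0 < gamma &
    forall q, (Gamma P Omega f s c `&` eball p eps) q ->
    exists g : 'rV[K]_n.+1 -> 'rV[K]_n.+1,
      [/\ holomorphic_embedding Omega g, g @` Omega `<=` eball 0 1,
        g q = 0 & eball 0 gamma `<=` g @` Omega]].
Proof.
move=> s0 sr c0; have r0 : 0 < r by exact: lt_trans sr.
have [B B0 hB] := cayley_bounded m_gt0 P_homogeneous P_continuous P_gt0 hK.
have [eta [rho [eta0 rho0 hrho]]] :=
  inversion_near_slab m_gt0 P_homogeneous P_continuous P_gt0 hK s0 sr c0.
have [eps eps0 heps] := near_extreme_zlast eta0.
(* Differences of points in bounded coordinates are at most 2 B, and coordinates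
   at most 1 / (n + 2) make the Euclidean norm of a row of length n + 1 less
   than 1. *)
pose a : K := (2 * B * n.+2%:R)^-1.
have a0 : 0 < a by rewrite invr_gt0 !mulr_gt0.
exists eps, (a * rho); split => //; first exact: mulr_gt0.
move=> q [[cq [/(innerE _ s0) wD wc]] qp].
case: hf => _ [ef fmodel _ Dsub].
pose w := f q; pose delta := 'Re (zlast w).
have delta0 : 0 < delta.
  rewrite -(@pmulr_rgt0 _ (2 * s)); last exact: mulr_gt0.
  apply: le_lt_trans wD.
  by rewrite addr_ge0 // exprn_ge0.
have delta_eta : delta < eta.
  apply: le_lt_trans (heps _ qp); apply: le_trans (leif_normC_Re_Creal _).
  by rewrite gtr0_norm.
have M0 : (0 < 2 * wprod m)%N by rewrite muln_gt0 wprod_gt0.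
(* The dilation of parameter t divides the last coordinate by Re w_n. *)
pose t := (2 * wprod m).-root delta^-1.
have t0 : 0 < t by rewrite rootC_gt0 // invr_gt0.
have tE : t ^+ (2 * wprod m) = delta^-1 by rewrite rootCK.
have ReZ (x : K) : 'Re (delta^-1 * x) = delta^-1 * 'Re x.
  by rewrite ReMl // gtr0_real // invr_gt0.
have model_dilate x : closure Omega x ->
    P (zprime (dilate m t (f x))) <= 2 * 'Re (zlast (dilate m t (f x))).
  move=> cx; rewrite zprime_dilate P_homogeneous // zlast_dilate tE ReZ mulrCA.
  by rewrite ler_pM2l ?invr_gt0 //; apply: closure_model; apply: fmodel; exists x.
pose y0 := dilate m t w.
have y0S : slab P c s y0.
  split; first split => /=.
  - by rewrite zlast_dilate tE ReZ mulVf // gt_eqF.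
  - rewrite zlast_dilate tE normrM gtr0_norm ?invr_gt0 // ler_pdivrMl //.
    rewrite mulrDr mulr1.
    apply: le_trans (_ : `|'Re (zlast w)| + `|'Im (zlast w)| <= _).
      rewrite {1}[zlast w]Crect; apply: le_trans (ler_normD _ _) _.
      by rewrite normrM normCi mul1r.
    apply: lerD; first by rewrite gtr0_norm.
    by rewrite mulrC -(gtr0_norm delta0).
  - rewrite /= zprime_dilate P_homogeneous // tE ler_pdivrMl // mulrC.
    by apply/ltW/(le_lt_trans _ wD); rewrite lerDr exprn_ge0.
pose b := cayley y0.
pose g x := a *: (cayley (dilate m t (f x)) - b).
have Re_ge0 x : closure Omega x -> 0 <= 'Re (zlast (dilate m t (f x))).
  move=> /model_dilate hx; rewrite -(@pmulr_rge0 _ 2) //.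
  exact: le_trans hx.
exists g; split.
- apply: holomorphic_embedding_sub (@subset_closure _ Omega) _.
  by apply: holomorphic_embedding_affine_cayley; rewrite ?gt_eqF.
- move=> _ [x Ox <-]; rewrite /eball /= subr0; apply: enorm_lt1 => i.
  have -> : g x 0 i = a * (cayley (dilate m t (f x)) 0 i - b 0 i).
    by rewrite mxE; congr (a * _); rewrite mxE; congr (_ + _); rewrite mxE.
  rewrite normrM gtr0_norm // mulrC -ler_pdivlMr //.
  rewrite /a invrK [leRHS]mulrC mulfK ?pnatr_eq0 // mulr_natl mulr2n.
  apply: le_trans (ler_normB _ _) (lerD _ _).
    exact/hB/model_dilate/subset_closure.
  exact/hB/model_dilate.
- by rewrite /g subrr scaler0.
- move=> u; rewrite /eball /= subr0 => hu.
  have a1 : 0 < a^-1 by rewrite invr_gt0.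
  have hu' i : `|(a^-1 *: u) 0 i| < rho.
    rewrite mxE normrM (gtr0_norm a1) ltr_pdivrMl //.
    exact: le_lt_trans (enorm_coord _ _) hu.
  have [v0 hv] := hrho _ _ y0S hu'.
  set v := cayley y0 + _ in v0 hv; set y := inversion v - _ in hv.
  have [] : (f @` Omega) (dilate m t^-1 y).
    apply: Dsub; apply/(innerE _ r0).
    rewrite zlast_dilate zprime_dilate P_homogeneous ?invr_gt0 // exprVn tE invrK.
    rewrite normrM gtr0_norm // ReMl ?gtr0_real //.
    set N := `|zlast y|; set x := 'Re (zlast y).
    rewrite (_ : _ + _ = delta * (delta * N ^+ 2 + P (zprime y))); last by ring.
    rewrite (_ : 2 * r * _ = delta * (2 * r * x)); last by ring.
    (* This is where Re w_n < eta, that is, q close to p, is needed. *)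
    rewrite ltr_pM2l //; apply: le_lt_trans hv.
    by rewrite lerD2r ler_wpM2r ?(ltW delta_eta) // exprn_ge0 // normr_ge0.
  move=> x Ox fx; exists x => //; rewrite /g fx.
  have -> : dilate m t (dilate m t^-1 y) = y.
    by rewrite -{1}[t]invrK dilateK // invr_eq0 gt_eqF.
  rewrite /y /cayley subrK inversionK // /v -/(cayley y0) addrAC subrr add0r.
  by rewrite scalerA mulfV ?scale1r // gt_eqF.
Qed.

End ExtremePoint.

(** * The squeezing function over the complex numbers *)

(** A closed disk is closed in the image of a square by [(x, y) |-> x + i y]. *)
Lemma compact_disks_complex (R : realType) : compact_disks (R[i]).
Proof.
pose K : numClosedFieldType := R[i].
pose F (p : R * R) : K := p.1%:C + 'i * p.2%:C.
have cC : continuous (fun x : R => x%:C : K).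
  move=> x; apply/(@cvgrPdist_lt _ _ _ (nbhs x)) => e e0.
  have eE : e = (complex.Re e)%:C by rewrite RRe_real // gtr0_real.
  have e0' : 0 < complex.Re e by rewrite -ltcR -eE.
  apply: filterS (nbhsx_ballx x _ e0') => y; rewrite /ball /= => xy.
  by rewrite -rmorphB normc_def /= expr0n addr0 sqrtr_sqr eE ltcR.
have cF : continuous F.
  move=> p.
  have c1 : {for p, continuous (fun p : R * R => p.1%:C : K)}.
    apply: (@continuous_comp _ _ _ fst (fun x : R => x%:C : K)).
      exact: cvg_fst.
    exact: cC.
  have c2 : {for p, continuous (fun p : R * R => p.2%:C : K)}.
    apply: (@continuous_comp _ _ _ snd (fun x : R => x%:C : K)).
      exact: cvg_snd.
    exact: cC.
  have ci : {for p, continuous (fun=> 'i : K)} by exact: cst_continuous.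
  exact: continuousD c1 (continuousM ci c2).
move=> B; pose b := complex.Re B.
have cI := compact_setX (@segment_compact R (- b) b) (@segment_compact R (- b) b).
have cFI : compact (F @` (`[- b, b] `*` `[- b, b])).
  by apply: continuous_compact cI; exact: continuous_subspaceT.
apply: (subclosed_compact _ cFI).
  exact/closed_preimage_le/norm_continuous.
move=> x /= xB; exists (complex.Re x, complex.Im x); last by rewrite /F /= -complexE.
have Bb : B = b%:C by rewrite /b RRe_real // ger0_real // (le_trans _ xB).
split => /=; rewrite in_itv /= -ler_norml -lecR -Bb; apply: le_trans xB.
  exact: normc_ge_Re.
rewrite -normrN -ReiNIm; apply: le_trans (normc_ge_Re _) _.
by rewrite normrM normCi mulr1.
Qed.

(** The two suprema defining the squeezing function are of sets bounded by [1]: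
    a larger ball centred at [0] contains a unit vector, which is not in the
    open unit ball. *)
Lemma squeezing_ge (R : realType) d (Omega : set 'rV[R[i]]_d.+1)
    (g : 'rV[R[i]]_d.+1 -> 'rV[R[i]]_d.+1) q rho :
  holomorphic_embedding Omega g -> g @` Omega `<=` eball 0 1 -> g q = 0 ->
  0 < rho -> eball 0 rho%:C `<=` g @` Omega -> rho <= squeezing Omega q.
Proof.
have ubr (h : 'rV[R[i]]_d.+1 -> 'rV[R[i]]_d.+1) : h @` Omega `<=` eball 0 1 ->
    ubound [set s : R | 0 < s /\ eball 0 s%:C `<=` h @` Omega] 1.
  move=> h1 s [s0 hs]; rewrite leNgt; apply/negP => s1.
  have e1 : enorm (delta_mx 0 0 - 0 : 'rV[R[i]]_d.+1) = 1.
    rewrite subr0 /enorm (bigD1 0) //= mxE !eqxx normr1 expr1n.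
    rewrite big1 ?addr0 ?sqrtC1 //.
    by move=> i i0; rewrite mxE (negPf i0) normr0 expr0n.
  have /hs/h1 : (eball 0 s%:C) (delta_mx 0 0 : 'rV[R[i]]_d.+1).
    by rewrite /eball /= e1 (ltcR 1).
  by rewrite /eball /= e1 ltxx.
move=> eg g1 gq rho0 hrho.
apply: (@le_trans _ _ (squeezing_radius Omega g)).
  by apply: ub_le_sup; [exists 1; exact: ubr|split].
apply: ub_le_sup; last by exists g.
exists 1 => _ [h [_ h1 _] <-].
rewrite /squeezing_radius; set S := mkset _.
have [->|/set0P S0] := eqVneq S set0; first by rewrite sup0.
by apply: sup_le_ub => //; exact: ubr.
Qed.

Theorem theorem1p3 (R : realType) (n : nat) (hn : (2 <= n.+1)%N)
  (m : 'I_n -> nat) (hm : forall j, (0 < m j)%N)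
  (a : {ffun 'I_n -> nat} -> {ffun 'I_n -> nat} -> R[i])
  (ha : forall k l, wt m k = 2^-1 -> wt m l = 2^-1 -> a k l = (a l k)^*)
  (hP : forall z : 'rV[R[i]]_n, z != 0 -> 0 < wpoly m a z)
  (Omega : set 'rV[R[i]]_n.+1) (hOmega : domain Omega)
  (r : R) (hr0 : 0 < r) (hr1 : r <= 1)
  (p : 'rV[R[i]]_n.+1) (f : 'rV[R[i]]_n.+1 -> 'rV[R[i]]_n.+1)
  (hf : extreme_via (wpoly m a) r%:C Omega p f) :
  forall r' c : R, 0 < r' -> r' < r -> 0 < c ->
  exists eps0 gamma0 : R, [/\ 0 < eps0, 0 < gamma0 &
    forall q, (Gamma (wpoly m a) Omega f r'%:C c%:C `&` eball p eps0%:C) q ->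
      gamma0 < squeezing Omega q].
Proof.
move=> r' c r'0 r'r c0.
have [eps [gamma [eps0 gamma0 H]]] :=
  uniform_embedding_at_extreme_point hm (wpoly_homogeneous hm a)
    (@continuous_wpoly _ _ _ hm a) hP (@compact_disks_complex R) hf
    (s := r'%:C) (c := c%:C) (etrans (ltcR 0 r') r'0) (etrans (ltcR _ _) r'r)
    (etrans (ltcR 0 c) c0).
have epsE : eps = (complex.Re eps)%:C by rewrite RRe_real // gtr0_real.
have gammaE : gamma = (complex.Re gamma)%:C by rewrite RRe_real // gtr0_real.
have Reeps0 : 0 < complex.Re eps by rewrite -ltcR -epsE.
have Regamma0 : 0 < complex.Re gamma by rewrite -ltcR -gammaE.
(* Half of gamma, because the required inequality is strict. *)
exists (complex.Re eps), (complex.Re gamma / 2); split => //.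
  exact: divr_gt0.
rewrite -epsE => q /H[g [eg g1 gq hg]].
apply: (@lt_le_trans _ _ (complex.Re gamma)).
  by rewrite ltr_pdivrMr // ltr_pMr // ltr1n.
by apply: squeezing_ge eg g1 gq Regamma0 _; rewrite -gammaE.
Qed.
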